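(* Fix $d\ge1$ and let $y_1,y_2,\dots$ and $\beta$ be indeterminates. For every partition $\lambda$ of $n$ with $\ell(\lambda)\le d$ (set $\lambda_i=0$ for $i>\ell(\lambda)$), $$\sum_{T\in\operatorname{SIT}(\lambda)}\prod_{k=1}^{m(T)}\left(\left[\prod_{i=1}^d\frac{1+\beta\,y_{\nu_i(T_{<k})+d-i+1}}{1+\beta\,y_{\lambda_i+d-i+1}}\right]-1\right)^{-1}=\frac{1}{\beta^n}\prod_{i=1}^d\big(1+\beta\,y_{\lambda_i+d-i+1}\big)^{\lambda_i}\prod_{(i,j)\in\lambda}\frac{1}{y_{d+j-\lambda'_j}-y_{\lambda_i+d-i+1}}.$$
   Context: Partitions are identified with Young diagrams $\{(i,j):1\le j\le\lambda_i\}$ (English convention); $\lambda'$ is the conjugate partition. A standard increasing tableau of shape $\lambda$ is a filling $T$ of the cells of $\lambda$ by positive integers, strictly increasing along rows and down columns, whose set of entries is $\{1,\dots,m\}$ for some $m=m(T)$; $\operatorname{SIT}(\lambda)$ is their set. For $k\ge1$, $\nu(T_{<k})$ is the partition formed by the cells with entry $<k$, and $\nu_i(T_{<k})$ its $i$-th part (0 beyond its length). The identity is one of rational functions in $\beta,y_1,y_2,\dots$. *)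

(* Defs.v *)
From HB Require Import structures.
From mathcomp Require Import all_boot all_algebra.
From mathcomp Require Import mpoly.
Set Implicit Arguments. Unset Strict Implicit. Unset Printing Implicit Defensive.
Import GRing.Theory.
Local Open Scope ring_scope.

Definition is_partition (la : seq nat) : bool :=
  sorted geq la && all (fun x => 0 < x)%N la.

(* 0-based parts: part la i = lambda_{i+1}, 0 beyond the length. *)
Definition part (la : seq nat) (i : nat) : nat := nth 0%N la i.

(* conjugate: conj_part la j = lambda'_j = #{ i : lambda_i >= j } (1-based j). *)
Definition conj_part (la : seq nat) (j : nat) : nat :=
  count (fun x => j <= x)%N la.

(* Fillings of the cells of la (0-based cell (i,j), i < d, j < n);
   the value on non-cells is irrelevant and fixed to 0. *)
Definition filling (d n : nat) := {ffun 'I_d * 'I_n -> 'I_n.+1}.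

Definition in_shape (la : seq nat) d n (c : 'I_d * 'I_n) : bool :=
  (c.2 < part la c.1)%N.

Definition mT d n (T : filling d n) : nat := (\max_(c : 'I_d * 'I_n) (T c : nat))%N.

Definition is_SIT (la : seq nat) d n (T : filling d n) : bool :=
  [forall c, ~~ in_shape la c ==> (T c == ord0)] &&
  [forall c, in_shape la c ==> (0 < T c)%N] &&
  [forall c, forall c', (in_shape la c && in_shape la c' &&
       (c.1 == c'.1) && (c.2 < c'.2)%N) ==> (T c < T c')%N] &&
  [forall c, forall c', (in_shape la c && in_shape la c' &&
       (c.2 == c'.2) && (c.1 < c'.1)%N) ==> (T c < T c')%N] &&
  [forall k : 'I_n.+1, ((0 < k)%N && (k <= mT T)%N) ==>
       [exists c, in_shape la c && (T c == k)]].

Definition nu (la : seq nat) d n (T : filling d n) (k : nat) (i : 'I_d) : nat :=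
  #|[set j : 'I_n | in_shape la (i, j) & (T (i, j) < k)%N]|.

(* The field of rational functions Q(beta, y_1, ..., y_{N-1}):
   variable 0 is beta, variable k (1 <= k < N) is y_k. *)
Definition RF (N : nat) := {fraction {mpoly rat[N]}}.

Definition beta (N : nat) : RF N.+1 := FracField.tofrac ('X_(@ord0 N) : {mpoly rat[N.+1]}).
Definition yv (N : nat) (k : nat) : RF N.+1 := FracField.tofrac ('X_(@inord N k) : {mpoly rat[N.+1]}).

(* Main.v *)
(* Put x_k = 1 + beta y_k and z_i = x_(la_i + d - i + 1).  A tableau is the chain of
   partitions nu (T_(<k)), consecutive ones differing by a nonempty set of corners,
   so the sum over tableaux of shape la / mu is determined by a recursion on mu.
   The factorial Grothendieck polynomials, written as the bialternants
     H mu = det [ prod_(k <= mu_j + d - j) (x_k / z_i - 1) / z_i ^ (j - 1) ],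
   satisfy the K-theoretic Chevalley rule
     (prod_i x_(mu_i + d - i + 1) / z_i) H mu = sum_nu H nu,
   over the nu obtained from mu by adding any set of corners, and H nu = 0 unless nu
   is contained in la.  Hence the sum for la / mu is H mu / H la.  At mu = 0, H 0 is a
   Vandermonde determinant and H la is triangular, which yields the hook product. *)
Require Import Defs.
From HB Require Import structures.
From mathcomp Require Import all_boot all_algebra.
From mathcomp Require Import mpoly.
From mathcomp Require Import perm.
From mathcomp Require Import zify ring.
Import GRing.Theory.
Local Open Scope ring_scope.

Set Implicit Arguments.
Unset Strict Implicit.
Unset Printing Implicit Defensive.

(** * Determinants: expansion over sets of columns, and a monic Vandermonde *)

Section Multilinearity.
Variables (R : comNzRingType) (d : nat).
Implicit Types A B : 'M[R]_d.

(** After transposing, each Leibniz term is a product over the columns; distributing this product of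
    binomials gives the sets [S]. *)
Lemma det_addmx_cols A B :
  \det (A + B) =
  \sum_(S : {set 'I_d}) \det (\matrix_(i, j) if j \in S then B i j else A i j).
Proof.
rewrite -det_tr [LHS]/determinant.
under [RHS]eq_bigr => S _ do rewrite -det_tr /determinant.
rewrite exchange_big /=; apply: eq_bigr => s _; rewrite -big_distrr /=.
congr (_ * _).
under eq_bigr => i _ do rewrite !mxE addrC.
rewrite bigA_distr; apply: eq_bigr => S _.
by apply: eq_bigr => i _; rewrite !mxE.
Qed.

(** The matrix is, up to transposition, the unitriangular matrix of coefficients of the [p j] times
    the ordinary Vandermonde matrix. *)
Lemma det_monic_Vandermonde (p : 'I_d -> {poly R}) (u : 'I_d -> R) :
  (forall j, p j \is monic) -> (forall j, size (p j) = j.+1) ->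
  \det (\matrix_(i, j) (p j).[u i]) =
  \prod_(i < d) \prod_(j < d | (i < j)%N) (u j - u i).
Proof.
move=> pm ps.
pose V := Vandermonde d (\row_i u i); pose C := \matrix_(j < d, k < d) (p j)`_k.
have -> : \matrix_(i, j) (p j).[u i] = (C *m V)^T.
  apply/matrixP=> i j; rewrite !mxE (horner_coef_wide _ (n := d)) ?ps //.
  by apply: eq_bigr => k _; rewrite !mxE.
rewrite det_tr det_mulmx det_Vandermonde det_trig; last first.
  by apply/is_trig_mxP=> i j lt_ij; rewrite mxE nth_default ?ps.
rewrite big1 ?mul1r; last first.
  by move=> i _; rewrite mxE; have /monicP := pm i; rewrite lead_coefE ps.
by apply: eq_bigr => i _; apply: eq_bigr => j _; rewrite !mxE.
Qed.

End Multilinearity.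

(** * Rows of a partition in which a cell can be added *)

Section AddableRows.
Variable d : nat.
Implicit Types (mu : 'I_d -> nat) (S : {set 'I_d}).

(** Comparing with all earlier rows avoids a predecessor in ['I_d] and needs no special case for row
    0; for weakly decreasing [mu] the previous row decides. *)
Definition addable mu : {set 'I_d} :=
  [set i : 'I_d | [forall i' : 'I_d, (i' < i)%N ==> (mu i < mu i')%N]].

Definition add_rows mu S (i : 'I_d) : nat :=
  mu i + (i \in S).

(** Some earlier row has part at most [mu j]; monotonicity squeezes the row just above [j] between
    the two. *)
Lemma nonaddable_prev mu (j : 'I_d) :
  {homo mu : i i' / (i <= i')%N >-> (i' <= i)%N} -> j \notin addable mu ->
  exists2 k : 'I_d, k.+1 = j :> nat & mu k = mu j.
Proof.
move=> mu_mono; rewrite inE negb_forall => /existsP[i].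
rewrite negb_imply -leqNgt => /andP[lt_ij le_mu].
have lt_kd : (j.-1 < d)%N by have := ltn_ord j; lia.
exists (Ordinal lt_kd) => /=; first lia.
have H1 := mu_mono (Ordinal lt_kd) j; have H2 := mu_mono i (Ordinal lt_kd).
by move: H1 H2 => /=; lia.
Qed.

Lemma add_rows_mono mu S :
  {homo mu : i i' / (i <= i')%N >-> (i' <= i)%N} -> S \subset addable mu ->
  {homo add_rows mu S : i i' / (i <= i')%N >-> (i' <= i)%N}.
Proof.
move=> mu_mono /subsetP sub i i' le_i; rewrite /add_rows.
have [e | ne] := eqVneq i i'; first by rewrite e.
have [i'S | _] := boolP (i' \in S).
  have := sub _ i'S; rewrite inE => /forallP/(_ i).
  have -> /= : (i < i')%N by rewrite ltn_neqAle le_i andbT.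
  by lia.
by rewrite addn0 (leq_trans (mu_mono _ _ le_i)) ?leq_addr.
Qed.

End AddableRows.

(** * Bialternants and their K-theoretic Chevalley rule *)

Section FactorialGrothendieck.
Variables (F : fieldType) (x : nat -> F) (d : nat).
Hypothesis x_neq0 : forall k, x k != 0.

(** A K-theoretic factorial power: for [x k] $=1+\beta y_k$ and $z=1+\beta t$ the factor is
    $\beta(y_k-t)/(1+\beta t)$. *)
Definition kpow (z : F) (M : nat) : F := \prod_(1 <= k < M) (x k / z - 1).

(* This is, up to the Vandermonde factor in z, the factorial Grothendieck
   polynomial of mu, with x k standing for 1 + beta y_k. *)
Definition bialternant (z : 'I_d -> F) (mu : 'I_d -> nat) : F :=
  \det (\matrix_(i, j) (kpow (z i) (mu j + d - j) / z i ^+ j)).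

(** The Chevalley rule for a single row. At [M = 0] it would fail, since both products on the left
    are empty. *)
Lemma kpowS z M : (0 < M)%N -> kpow z M + kpow z M.+1 = x M / z * kpow z M.
Proof. by move=> M0; rewrite {2}/kpow big_nat_recr //= -/(kpow z M); ring. Qed.

Lemma eq_bialternant z mu nu : mu =1 nu -> bialternant z mu = bialternant z nu.
Proof.
by move=> e; congr determinant; apply/matrixP=> i j; rewrite !mxE e.
Qed.

(* Pieri-Chevalley rule.  Multiplying column j by x_(mu_j + d - j) / z_i turns it
   into the sum of the columns for mu_j and mu_j + 1; when row j is not addable
   the latter column is a multiple of the previous full column. *)
Lemma bialternant_Chevalley z (mu : 'I_d -> nat) :
    (forall i, z i != 0) ->
    {homo mu : i i' / (i <= i')%N >-> (i' <= i)%N} ->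
  (\prod_(i < d) (x (mu i + d - i) / z i)) * bialternant z mu =
  \sum_(S : {set 'I_d} | S \subset addable mu) bialternant z (add_rows mu S).
Proof.
move=> z0 mu_mono.
pose A := \matrix_(i < d, j < d) (kpow (z i) (mu j + d - j) / z i ^+ j).
(* Columns of non-addable rows vanish in [B], so a set [S] using one of them contributes 0 to the
   expansion of [\det (A + B)]. *)
pose B := \matrix_(i < d, j < d)
  ((j \in addable mu)%:R * (kpow (z i) (mu j + d - j).+1 / z i ^+ j)).
(* If row [j] is not addable, rows [j-1] and [j] of [mu] agree, and column [j-1] of [A] divided by
   [z i] is exactly the term left out of column [j] of [B]. The unitriangular [U] subtracts it. *)
pose U := \matrix_(k < d, j < d) ((k == j)%:R -
  ((j \notin addable mu) && (k.+1 == j))%:R / x (mu k + d - k)).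
have pos (j : 'I_d) : (0 < mu j + d - j)%N by have := ltn_ord j; lia.
have -> : \sum_(S : {set 'I_d} | S \subset addable mu)
    bialternant z (add_rows mu S) = \det (A + B).
  rewrite det_addmx_cols big_mkcond /=; apply: eq_bigr => S _.
  case: ifPn => [sub | /subsetPn[j jS jA]].
    congr determinant; apply/matrixP=> i j; rewrite !mxE /add_rows.
    case: ifPn => [jS | _]; last by rewrite addn0.
    rewrite (subsetP sub _ jS) mul1r; congr (kpow _ _ / _).
    by have := ltn_ord j; lia.
  symmetry; rewrite -det_tr (expand_det_row _ j) big1 // => i _.
  by rewrite !mxE jS (negPf jA) !mul0r.
have -> : A + B = (\matrix_(i, j)
    (x (mu j + d - j) / z i * A i j)) *m U.
  apply/matrixP=> i j; rewrite !mxE.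
  under eq_bigr => k _ do rewrite !mxE mulrBr.
  rewrite sumrB (bigD1 j) //= eqxx mulr1 big1 ?addr0; last first.
    by move=> k /negPf ->; rewrite mulr0.
  have [jA | jA] := boolP (j \in addable mu).
    rewrite big1 ?subr0; last by move=> k _; rewrite mul0r mulr0.
    by rewrite mul1r -mulrDl kpowS // !mulrA.
  rewrite mul0r addr0 mulrA -kpowS // mulrDl.
  have [k kj muk] := nonaddable_prev mu_mono jA.
  rewrite (bigD1 k) //= kj eqxx big1 ?addr0 => [|k' nek]; last first.
    rewrite (_ : (_ == _) = false) ?mul0r ?mulr0 //.
    by apply: contraNF nek => /eqP ek; apply/eqP/val_inj => /=; lia.
  rewrite muk (_ : (mu j + d - k = (mu j + d - j).+1)%N); last first.
    by have := ltn_ord j; lia.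
  rewrite -kj exprS; apply/eqP; rewrite -subr_eq0; apply/eqP.
  rewrite -[true%:R]/(1 : F); field.
  by rewrite z0 x_neq0 expf_neq0.
rewrite det_mulmx.
have -> : \det U = 1.
  rewrite -det_tr det_trig => [|]; last first.
    apply/is_trig_mxP=> i j lt_ij; rewrite !mxE.
    rewrite (_ : (j == i) = false) 1?(_ : (j.+1 == i) = false) ?andbF ?mul0r ?subr0 //.
      by apply/eqP => e; lia.
    by apply/eqP => e; move: lt_ij; rewrite e ltnn.
  apply: big1 => i _; rewrite !mxE eqxx (_ : (i.+1 == i) = false) ?andbF ?mul0r ?subr0 //.
  by apply/eqP; lia.
rewrite mulr1.
have -> : \matrix_(i, j) (x (mu j + d - j) / z i * A i j) =
    diag_mx (\row_i (z i)^-1) *m A *m diag_mx (\row_j x (mu j + d - j)).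
  by apply/matrixP=> i j; rewrite mul_mx_diag mul_diag_mx !mxE; ring.
rewrite !det_mulmx !det_diag /bialternant -/A big_split /=.
under [X in _ = X * _ * _]eq_bigr => i _ do rewrite mxE.
under [X in _ = _ * X]eq_bigr => i _ do rewrite mxE.
ring.
Qed.

Lemma kpow_eq0 (L M : nat) : (0 < L < M)%N -> kpow (x L) M = 0.
Proof.
move=> /andP[L0 LM]; apply/eqP; rewrite prodf_seq_eq0; apply/hasP; exists L.
  by rewrite mem_index_iota L0.
by rewrite divff ?subrr ?x_neq0 /=.
Qed.

(** Every permutation meets the zero block: otherwise it would map the indices at least [p]
    injectively into those greater than [p]. *)
Lemma det_zero_block (M : 'M[F]_d) (p : 'I_d) :
  (forall i j : 'I_d, (j <= p <= i)%N -> M i j = 0) -> \det M = 0.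
Proof.
move=> M0; rewrite /determinant big1 // => /= s _.
have [/existsP[i /andP[pi sp]] | no] :=
    boolP [exists i : 'I_d, (p <= i)%N && (s i <= p)%N].
  by rewrite (bigD1 i) //= M0 ?mul0r ?mulr0 // sp.
have sub : s @: [set i : 'I_d | (p <= i)%N] \subset [set i : 'I_d | (p <= i)%N] :\ p.
  apply/subsetP=> _ /imsetP[i /[!inE] pi ->].
  have:= forallP (etrans (esym (negb_exists _)) no) i.
  rewrite pi /= -ltnNge => lt; rewrite (ltnW lt) andbT.
  by apply: contraTneq lt => ->; rewrite ltnn.
have := subset_leq_card sub; rewrite card_imset; last exact: perm_inj.
by rewrite [X in (X <= _)%N](cardsD1 p) inE leqnn ltnn.
Qed.

Lemma kpow_mul (z : F) M : z != 0 ->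
  kpow z M = \prod_(1 <= k < M) (x k - z) / z ^+ M.-1.
Proof.
move=> z0; rewrite /kpow -subn1 -prodr_const_nat -prodf_div.
by apply: eq_bigr => k _; rewrite mulrBl divff.
Qed.

Lemma det_rev (M : 'M[F]_d) :
  \det (\matrix_(i, j) M (rev_ord i) (rev_ord j)) = \det M.
Proof.
pose s := perm (@rev_ord_inj d).
have -> : \matrix_(i, j) M (rev_ord i) (rev_ord j) = row_perm s (col_perm s M).
  by apply/matrixP=> i j; rewrite !mxE !permE.
rewrite row_permE col_permE !det_mulmx !det_perm odd_permV mulrCA -signr_addb.
by rewrite addbb mulr1.
Qed.

(** Row [i] times [z i ^+ d.-1] has entries $\prod_{1\le k<d-j}(x_k-z_i)$, monic of degree $d-1-j$
    in $-z_i$. Reversing rows and columns makes the degrees increase, as [det_monic_Vandermonde]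
    requires. *)
Lemma bialternant0 (z : 'I_d -> F) : (forall i, z i != 0) ->
  bialternant z (fun=> 0%N) =
  \prod_(i < d) ((z i ^+ d.-1)^-1 * \prod_(j < d | (i < j)%N) (z j - z i)).
Proof.
move=> z0.
pose q (j : 'I_d) := \prod_(k <- index_iota 1 j.+1) ('X - (- x k)%:P).
have qm j : q j \is monic by apply: monic_prod_XsubC.
have qs j : size (q j) = j.+1 by rewrite size_prod_XsubC size_iota subn1.
have := det_monic_Vandermonde (fun i => - z (rev_ord i)) qm qs.
rewrite -det_rev => Vd.
pose M := \matrix_(i < d, j < d) \prod_(1 <= k < d - j) (x k - z i).
have -> : bialternant z (fun=> 0%N) = \det (diag_mx (\row_i (z i ^+ d.-1)^-1) *m M).
  congr determinant; apply/matrixP=> i j; rewrite mul_diag_mx !mxE kpow_mul //.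
  rewrite add0n -mulrA -invfM -exprD mulrC; congr ((_ ^+ _)^-1 * _).
  by have := ltn_ord j; lia.
have <- : \matrix_(i, j) (\matrix_(i, j) (q j).[- z (rev_ord i)]) (rev_ord i) (rev_ord j) = M.
  apply/matrixP=> i j; rewrite !mxE rev_ordK horner_prod /= subnSK //.
  by apply: eq_bigr => k _; rewrite hornerXsubC opprK addrC.
rewrite det_mulmx det_diag Vd big_split /=; congr (_ * _).
  by apply: eq_bigr => i _; rewrite mxE.
(* The sign from evaluating at [- z] is absorbed by the reversed order of each pair. *)
rewrite (reindex_inj rev_ord_inj) /=.
under eq_bigr => i _ do rewrite (reindex_inj rev_ord_inj) /=.
rewrite (exchange_big_dep xpredT) //=; apply: eq_bigr => i _.
apply: eq_big => [j | j _]; last by rewrite !rev_ordK; ring.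
by have := ltn_ord i; have := ltn_ord j; lia.
Qed.

(** * Vanishing and triangularity at the point $z_i=x_{\lambda_i+d-i}$ (rows from 0) *)

Section Localization.
Variables (lam : 'I_d -> nat) (z : 'I_d -> F).
Hypothesis lam_mono : {homo lam : i i' / (i <= i')%N >-> (i' <= i)%N}.
Hypothesis zE : forall i, z i = x (lam i + d - i).

(** For [j <= p <= i] one has [lam i <= lam p < mu p <= mu j], so the product in entry [(i, j)]
    contains the factor that vanishes at [z i]. *)
Lemma bialternant_eq0 (mu : 'I_d -> nat) (p : 'I_d) :
  {homo mu : i i' / (i <= i')%N >-> (i' <= i)%N} -> (lam p < mu p)%N ->
  bialternant z mu = 0.
Proof.
move=> mu_mono lt_p; apply: (@det_zero_block _ p) => i j /andP[jp pi].
rewrite mxE zE kpow_eq0 ?mul0r //.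
have := mu_mono _ _ jp; have := lam_mono pi; have := ltn_ord i; lia.
Qed.

(** The same vanishing kills all entries below the diagonal. *)
Lemma bialternant_diag :
  bialternant z lam = \prod_i (kpow (z i) (lam i + d - i) / z i ^+ i).
Proof.
rewrite /bialternant -det_tr det_trig => [|]; last first.
  apply/is_trig_mxP=> i j lt_ij; rewrite !mxE zE kpow_eq0 ?mul0r //.
  by have := lam_mono (ltnW lt_ij); have := ltn_ord j; lia.
by apply: eq_bigr => i _; rewrite !mxE.
Qed.

(** Row [i] carries $z_i^{-(d-1)}$ in the numerator and $z_i^{-(\lambda_i+d-1)}$ in the denominator,
    whence [z i ^+ lam i]. *)
Lemma bialternant_ratio :
  bialternant z (fun=> 0%N) / bialternant z lam =
  \prod_(i < d) (z i ^+ lam i * (\prod_(j < d | (i < j)%N) (z j - z i)) /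
    \prod_(1 <= k < lam i + d - i) (x k - z i)).
Proof.
have z0 i : z i != 0 by rewrite zE.
rewrite bialternant_diag bialternant0 // -prodf_div; apply: eq_bigr => i _.
rewrite kpow_mul // !invfM !invrK.
have -> : (lam i + d - i).-1 = (lam i + (d.-1 - i))%N by have := ltn_ord i; lia.
have e : (d.-1 = (d.-1 - i) + i)%N by have := ltn_ord i; lia.
rewrite {1}e !exprD.
set D := (\prod_(1 <= k < _) _)^-1; set P := \prod_(j < d | _) _.
by field; rewrite !expf_neq0.
Qed.

End Localization.

End FactorialGrothendieck.

(** * Skew increasing tableaux and the removal of their entries 1 *)

Section SkewTableaux.
Variables (la : seq nat) (d n : nat).
Implicit Types (T : filling d n) (mu : 'I_d -> nat) (S : {set 'I_d}).

Definition cell_lt (c c' : 'I_d * 'I_n) : bool :=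
  (c.1 == c'.1) && (c.2 < c'.2)%N || (c.2 == c'.2) && (c.1 < c'.1)%N.

(* Standard increasing tableaux of shape la / mu, extended by 0 on mu. *)
Definition skew_SIT mu T : bool :=
  [&& [forall c, (0 < T c)%N == in_shape la c && (mu c.1 <= c.2)%N],
      [forall c, forall c', cell_lt c c' && (0 < T c')%N ==> (T c < T c')%N] &
      [forall k : 'I_n.+1, (0 < k <= mT T)%N ==> [exists c, T c == k]]].

Lemma leq_mT T c : (T c <= mT T)%N.
Proof. exact: (@leq_bigmax _ (fun c => T c : nat)). Qed.

Lemma mT_leq T : (mT T <= n)%N.
Proof. by apply/bigmax_leqP => c _; rewrite -ltnS ltn_ord. Qed.

Lemma skew_SITP mu T :
  reflect [/\ forall c, (0 < T c)%N = in_shape la c && (mu c.1 <= c.2)%N,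
              forall c c', cell_lt c c' -> (0 < T c')%N -> (T c < T c')%N &
              forall k, (0 < k <= mT T)%N -> exists c, T c = k :> nat]
          (skew_SIT mu T).
Proof.
apply: (iffP and3P) => [[/forallP H1 /forallP H2 /forallP H3] | [H1 H2 H3]]; split.
- by move=> c; exact: (eqP (H1 c)).
- move=> c c' lt_c T0; have /forallP/(_ c') := H2 c.
  by rewrite lt_c T0.
- move=> k kT; have lt_k : (k < n.+1)%N by have := mT_leq T; lia.
  have := H3 (Ordinal lt_k); rewrite kT => /existsP[c /eqP e].
  by exists c; rewrite e.
- by apply/forallP=> c; apply/eqP.
- apply/forallP=> c; apply/forallP=> c'; apply/implyP=> /andP[]; exact: H2.
- apply/forallP=> k; apply/implyP=> /H3[c e]; apply/existsP; exists c.
  exact/eqP/val_inj.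
Qed.

(** Entries 1 become 0, so their cells pass to the inner shape. *)
Definition pred_filling T : filling d n := [ffun c => inord (T c).-1].

(** The inner shape [mu] tells which zeros are to become 1. *)
Definition succ_filling mu T : filling d n :=
  [ffun c => if in_shape la c && (mu c.1 <= c.2)%N then inord (T c).+1 else ord0].

Definition first_rows T : {set 'I_d} :=
  [set i : 'I_d | [exists j : 'I_n, T (i, j) == 1 :> nat]].

Lemma pred_fillingE T c : pred_filling T c = (T c).-1 :> nat.
Proof. by rewrite ffunE inordK //; have := ltn_ord (T c); lia. Qed.

Lemma pred_fillingK mu T : skew_SIT mu T -> succ_filling mu (pred_filling T) = T.
Proof.
move=> /skew_SITP[H1 _ _]; apply/ffunP=> c; apply/val_inj; rewrite ffunE -H1.
case: (posnP (T c)) => [Tc0 | Tc0] /=; first by rewrite Tc0.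
by rewrite pred_fillingE prednK // inordK.
Qed.

Lemma mT_pred T : mT (pred_filling T) = (mT T).-1.
Proof.
apply/eqP; rewrite eqn_leq; apply/andP; split.
  by apply/bigmax_leqP=> c _; rewrite pred_fillingE; have := leq_mT T c; lia.
suff : (mT T <= (mT (pred_filling T)).+1)%N by lia.
apply/bigmax_leqP=> c _.
by have := leq_mT (pred_filling T) c; rewrite pred_fillingE; lia.
Qed.

Hypothesis la_mono : {homo part la : i i' / (i <= i')%N >-> (i' <= i)%N}.

Lemma in_shape_mono c c' : cell_lt c c' -> in_shape la c' -> in_shape la c.
Proof.
case: c c' => [i j] [i' j'] /orP[] /andP[/eqP /= e lt_c]; rewrite /in_shape /=.
  by rewrite e; apply: ltn_trans.
by rewrite e => /leq_trans; apply; apply/la_mono/ltnW.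
Qed.

Lemma is_SIT_skew T : is_SIT la T = skew_SIT (fun=> 0%N) T.
Proof.
apply/idP/skew_SITP.
  move=> /andP[/andP[/andP[/andP[/forallP H0 /forallP H1] /forallP H2] /forallP H3] /forallP H4].
  have T0 c : (0 < T c)%N = in_shape la c && (0 <= c.2)%N.
    rewrite leq0n andbT; have := H0 c; have := H1 c.
    by case: (in_shape la c) => //= _ /eqP ->.
  split=> //.
    move=> c c' lt_c; rewrite T0 andbT => in_c'.
    have in_c := in_shape_mono lt_c in_c'; move: lt_c => /orP[] /andP[e lt_c].
      by have /forallP/(_ c') := H2 c; rewrite in_c in_c' e lt_c.
    by have /forallP/(_ c') := H3 c; rewrite in_c in_c' e lt_c.
  move=> k kT; have lt_k : (k < n.+1)%N by have := mT_leq T; lia.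
  have := H4 (Ordinal lt_k); rewrite kT => /existsP[c /andP[_ /eqP e]].
  by exists c; rewrite e.
move=> [H1 H2 H3]; do 4?[apply/andP; split].
- apply/forallP=> c; apply/implyP=> nc; apply/eqP/val_inj => /=.
  by have := H1 c; rewrite (negPf nc); case: (T c : nat).
- by apply/forallP=> c; apply/implyP=> ic; rewrite H1 ic.
- apply/forallP=> c; apply/forallP=> c'.
  apply/implyP=> /andP[/andP[/andP[_ ic'] e] lt_c].
  by apply: H2; rewrite ?H1 ?ic' // /cell_lt e lt_c.
- apply/forallP=> c; apply/forallP=> c'.
  apply/implyP=> /andP[/andP[/andP[_ ic'] e] lt_c].
  by apply: H2; rewrite ?H1 ?ic' // /cell_lt e lt_c orbT.
- apply/forallP=> k; apply/implyP=> kT; have [c e] := H3 _ kT.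
  apply/existsP; exists c; rewrite -val_eqE /= e eqxx andbT.
  by have := H1 c; rewrite e andbT => <-; case/andP: kT.
Qed.

Hypothesis la_sum : (\sum_(i < d) part la i = n)%N.

Lemma part_leq (i : 'I_d) : (part la i <= n)%N.
Proof. by rewrite -la_sum (bigD1 i) //= leq_addr. Qed.

Lemma card_row_lt m : (m <= n)%N -> #|[set j : 'I_n | (j < m)%N]| = m.
Proof.
move=> le_mn; rewrite cardsE -sum1_card -[RHS]card_ord -sum1_card.
by rewrite [RHS](big_ord_widen n (fun=> 1%N) le_mn); apply: eq_bigl.
Qed.

Lemma card_shape : #|[set c : 'I_d * 'I_n | in_shape la c]| = n.
Proof.
rewrite cardsE -sum1_card -[RHS]la_sum.
rewrite -(pair_big_dep xpredT (fun (i : 'I_d) (j : 'I_n) => (j < part la i)%N) (fun _ _ => 1%N)) /=.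
by apply: eq_bigr => i _; rewrite sum1_card -cardsE card_row_lt ?part_leq.
Qed.

(** Cells chosen for the values from 1 to [mT T] are distinct, lie in the shape and avoid [c], while
    the shape has [n] cells. The strict bound leaves room in ['I_n.+1] to raise all entries by 1. *)
Lemma skew_SIT_mT_lt mu T c :
  skew_SIT mu T -> in_shape la c -> T c = 0%N :> nat -> (mT T < n)%N.
Proof.
move=> /skew_SITP[H1 _ H3] ic Tc0.
have ex (k : 'I_(mT T)) : exists c', T c' = k.+1 :> nat by apply: H3; rewrite ltn_ord.
have [f fE] := fin_all_exists ex.
have f_inj : injective f.
  by move=> k k' e; apply/val_inj; have := fE k; rewrite e fE => -[].
rewrite -[X in (X < _)%N]card_ord -(card_imset _ f_inj) -[X in (_ < X)%N]card_shape.
apply: proper_card; apply/properP; split.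
  apply/subsetP=> _ /imsetP[k _ ->]; rewrite inE.
  by have := H1 (f k); rewrite fE => /esym/andP[].
exists c; rewrite ?inE //; apply/imsetP=> -[k _ e].
by have := fE k; rewrite -e Tc0.
Qed.

(** A cell of the skew shape to the left of or above an entry 1 would hold a positive entry smaller
    than 1. *)
Lemma skew_SIT_first mu T (i : 'I_d) (j : 'I_n) :
  {homo mu : i i' / (i <= i')%N >-> (i' <= i)%N} ->
  skew_SIT mu T -> T (i, j) = 1%N :> nat ->
  [/\ mu i = j, i \in addable mu & (mu i < part la i)%N].
Proof.
move=> mu_mono /skew_SITP[H1 H2 _] Tij.
have := H1 (i, j); rewrite Tij => /esym/andP[ic /= le_mu].
rewrite /in_shape /= in ic.
have mu_i : mu i = j.
  apply/eqP; rewrite eqn_leq le_mu leqNgt /=; apply/negP => lt_mu.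
  have lt_n : (mu i < n)%N by apply: ltn_trans (ltn_ord j).
  have lt_c : cell_lt (i, Ordinal lt_n) (i, j) by rewrite /cell_lt /= eqxx lt_mu.
  have := H2 _ _ lt_c; have := H1 (i, Ordinal lt_n); rewrite Tij.
  by rewrite /in_shape /= leqnn (ltn_trans lt_mu ic); lia.
split=> //; last by rewrite mu_i.
rewrite inE; apply/forallP=> i'; apply/implyP=> lt_i; rewrite ltnNge; apply/negP=> le_mu'.
have lt_c : cell_lt (i', j) (i, j) by rewrite /cell_lt /= eqxx lt_i orbT.
have := H2 _ _ lt_c; have := H1 (i', j); rewrite Tij.
rewrite /in_shape /= -{2}mu_i le_mu' (leq_trans ic (la_mono (ltnW lt_i))); lia.
Qed.

Lemma add_rows_first mu T (i : 'I_d) (j : 'I_n) :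
  {homo mu : i i' / (i <= i')%N >-> (i' <= i)%N} -> skew_SIT mu T ->
  (1 < T (i, j))%N = in_shape la (i, j) && (add_rows mu (first_rows T) i <= j)%N.
Proof.
move=> mu_mono sT; have /skew_SITP[H1 H2 _] := sT.
have := H1 (i, j); rewrite /add_rows /=.
have [T1 | neT1] := eqVneq (T (i, j) : nat) 1%N.
  have [mu_i _ _] := skew_SIT_first mu_mono sT T1.
  have -> : i \in first_rows T by rewrite inE; apply/existsP; exists j; apply/eqP.
  by rewrite T1 mu_i addn1 !ltnn andbF.
move=> H; rewrite ltn_neqAle eq_sym neT1 /= H; case: (in_shape la (i, j)) H => //= H.
have [iS | _] := boolP (i \in first_rows T); last by rewrite addn0.
move: iS; rewrite inE => /existsP[j' /eqP Tj'].
have [mu_i _ _] := skew_SIT_first mu_mono sT Tj'.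
rewrite addn1 [RHS]ltn_neqAle (_ : mu i != j) //.
apply: contraNneq neT1 => e; rewrite (_ : j = j') ?Tj' //.
by apply/val_inj; rewrite /= -e mu_i.
Qed.

Lemma skew_SIT_pred mu T :
  {homo mu : i i' / (i <= i')%N >-> (i' <= i)%N} -> skew_SIT mu T ->
  skew_SIT (add_rows mu (first_rows T)) (pred_filling T).
Proof.
move=> mu_mono sT; have /skew_SITP[H1 H2 H3] := sT; apply/skew_SITP; split.
- move=> [i j]; rewrite pred_fillingE -(add_rows_first _ _ mu_mono sT).
  by case: (T _ : nat) => [|[]].
- move=> c c' lt_c; rewrite !pred_fillingE; have := H2 c c' lt_c; lia.
- move=> k; rewrite mT_pred => kT; have [|c e] := H3 k.+1; first lia.
  by exists c; rewrite pred_fillingE e.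
Qed.

Lemma first_rows_neq0 mu T (p : 'I_d) :
  {homo mu : i i' / (i <= i')%N >-> (i' <= i)%N} -> skew_SIT mu T ->
  (mu p < part la p)%N -> first_rows T != set0.
Proof.
move=> mu_mono /skew_SITP[H1 H2 H3] lt_p.
have lt_n : (mu p < n)%N := leq_trans lt_p (part_leq p).
have [|[i j] /eqP e] := H3 1%N.
  have := leq_mT T (p, Ordinal lt_n); have := H1 (p, Ordinal lt_n).
  by rewrite /in_shape /= lt_p leqnn; lia.
by apply/set0Pn; exists i; rewrite inE; apply/existsP; exists j.
Qed.

(** * The inverse step: a set [S] of corners receives the entry 1 *)

Section Successor.
Variables (mu : 'I_d -> nat) (S : {set 'I_d}) (T : filling d n).
Hypothesis S_neq0 : S != set0.
Hypothesis S_add : S \subset addable mu.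
Hypothesis S_lt : {in S, forall i, (mu i < part la i)%N}.
Hypothesis sT : skew_SIT (add_rows mu S) T.

Lemma corner_eq0 (i : 'I_d) (j : 'I_n) : i \in S -> j = mu i :> nat -> T (i, j) = 0%N :> nat.
Proof.
move=> iS e; have /skew_SITP[/(_ (i, j)) + _ _] := sT.
by rewrite /add_rows /= iS e addn1 ltnn andbF; case: (nat_of_ord _).
Qed.

(** [inord] does not overflow: a corner from [S] is a cell of [la] where [T] is 0, hence
    [mT T < n]. *)
Lemma succ_fillingE c : succ_filling mu T c =
  (if in_shape la c && (mu c.1 <= c.2)%N then (T c).+1 else 0%N) :> nat.
Proof.
rewrite ffunE; case: ifP => // _; rewrite inordK // ltnS.
have /set0Pn[i iS] := S_neq0; have lt_i := S_lt iS.
have lt_n : (mu i < n)%N := leq_trans lt_i (part_leq i).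
apply: leq_ltn_trans (leq_mT T c) _.
by apply: (skew_SIT_mT_lt (c := (i, Ordinal lt_n)) sT) => //; apply: corner_eq0.
Qed.

Lemma succ_fillingK : pred_filling (succ_filling mu T) = T.
Proof.
apply/ffunP=> c; apply/val_inj; rewrite /= pred_fillingE succ_fillingE.
have /skew_SITP[/(_ c) + _ _] := sT; rewrite /add_rows.
case: ifP => //= /negbT; rewrite negb_and => /orP[/negPf -> /= | ].
  by case: (nat_of_ord _).
rewrite -ltnNge => lt; rewrite (leqNgt (_ + _)) (leq_trans lt) ?leq_addr ?andbF //.
by case: (nat_of_ord _).
Qed.

Lemma first_rows_succ : first_rows (succ_filling mu T) = S.
Proof.
apply/setP=> i; rewrite inE; apply/existsP/idP => [[j] | iS].
  rewrite succ_fillingE; case: ifP => //= /andP[ic le_mu]; rewrite eqSS => /eqP T0.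
  have /skew_SITP[/(_ (i, j)) + _ _] := sT.
  rewrite T0 ic /= /add_rows; case: (i \in S) => //.
  by rewrite addn0 le_mu.
have lt_i := S_lt iS; have lt_n : (mu i < n)%N := leq_trans lt_i (part_leq i).
exists (Ordinal lt_n); rewrite succ_fillingE /in_shape /= lt_i leqnn /=.
by rewrite corner_eq0.
Qed.

Lemma skew_SIT_succ : skew_SIT mu (succ_filling mu T).
Proof.
have /skew_SITP[H1 H2 H3] := sT; apply/skew_SITP; split.
- by move=> c; rewrite succ_fillingE; case: ifP.
- move=> c c' lt_c; rewrite !succ_fillingE; case: ifP => // /andP[ic' le_mu'] _.
  case: ifP => // /andP[ic le_mu]; rewrite ltnS.
  have := H2 _ _ lt_c; rewrite H1 ic' /= /add_rows.
  have [iS | _] := boolP (c'.1 \in S); last by rewrite addn0 le_mu' => /(_ isT).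
  rewrite addn1; case: ltngtP le_mu' => // [_ _ /(_ isT) // | e _ _].
  (* Here [c'] is a new corner. No cell of the skew shape precedes it: in its row by position, in
     its column by addability. *)
  have := subsetP S_add _ iS; rewrite inE => /forallP/(_ c.1).
  move: lt_c => /orP[] /andP[/eqP e1 lt_c].
    by move: le_mu lt_c; rewrite e1 e leqNgt => /negPf ->.
  by rewrite lt_c e -e1 ltnNge le_mu.
- case=> // -[|k] kT.
    have /set0Pn[i] := S_neq0; rewrite -{1}first_rows_succ inE => /existsP[j /eqP e].
    by exists (i, j).
  have [|c e] := H3 k.+1.
    by have := mT_pred (succ_filling mu T); rewrite succ_fillingK; lia.
  exists c; rewrite succ_fillingE e; have := H1 c; rewrite e /add_rows.
  case: (in_shape la c) => //= /esym le_mu.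
  by rewrite (leq_trans (leq_addr _ _) le_mu).
Qed.

End Successor.

(** Tableaux are grouped by the rows [S] holding an entry 1; on each group [pred_filling] and
    [succ_filling mu] are mutually inverse. The row [p] forces [S] to be nonempty. *)
Lemma sum_skew_SIT_rec (R : nmodType) mu (p : 'I_d) (f : filling d n -> R) :
    {homo mu : i i' / (i <= i')%N >-> (i' <= i)%N} -> (mu p < part la p)%N ->
  \sum_(T | skew_SIT mu T) f T =
  \sum_(S : {set 'I_d} | [&& S != set0, S \subset addable mu &
                          [forall i in S, (mu i < part la i)%N]])
    \sum_(T | skew_SIT (add_rows mu S) T) f (succ_filling mu T).
Proof.
move=> mu_mono lt_p.
rewrite (partition_big first_rows (fun S => [&& S != set0, S \subset addable mu &
   [forall i in S, (mu i < part la i)%N]])) /=; last first.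
  move=> T sT; rewrite (first_rows_neq0 mu_mono sT lt_p) /=.
  apply/andP; split.
    apply/subsetP=> i; rewrite inE => /existsP[j /eqP Tij].
    by have [] := skew_SIT_first mu_mono sT Tij.
  apply/forall_inP=> i; rewrite inE => /existsP[j /eqP Tij].
  by have [] := skew_SIT_first mu_mono sT Tij.
apply: eq_bigr => S /and3P[S0 Sadd /forall_inP Slt].
rewrite (reindex_onto (succ_filling mu) pred_filling) => [|T /andP[sT _]]; last first.
  exact: pred_fillingK.
apply: eq_bigl => T; apply/andP/idP => [[/andP[sT /eqP eS] /eqP eT] | sT].
  by rewrite -eT -eS; apply: skew_SIT_pred.
rewrite (skew_SIT_succ S0 Sadd Slt sT) (first_rows_succ S0 Slt sT).
by rewrite (succ_fillingK S0 Slt sT) !eqxx.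
Qed.

End SkewTableaux.

(** * The weighted sum over skew tableaux as a ratio of bialternants *)

Section HookSum.
Variables (F : fieldType) (x : nat -> F) (la : seq nat) (d n : nat).
Hypothesis x_neq0 : forall k, x k != 0.
Hypothesis la_mono : {homo part la : i i' / (i <= i')%N >-> (i' <= i)%N}.
Hypothesis la_sum : (\sum_(i < d) part la i = n)%N.
Implicit Types (T : filling d n) (mu : 'I_d -> nat) (S : {set 'I_d}).

Let lam (i : 'I_d) : nat := part la i.
Let z (i : 'I_d) : F := x (part la i + d - i).

Definition level_weight mu : F :=
  \prod_(i < d) (x (mu i + d - i) / x (part la i + d - i)) - 1.

Definition SIT_weight T : F :=
  \prod_(1 <= k < (mT T).+1) (level_weight (nu la T k))^-1.

Lemma eq_level_weight mu nu : mu =1 nu -> level_weight mu = level_weight nu.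
Proof. by move=> e; congr (_ - 1); apply: eq_bigr => i _; rewrite e. Qed.

Lemma nu1_skew_SIT mu T : (forall i, mu i <= lam i)%N -> skew_SIT la mu T ->
  nu la T 1 =1 mu.
Proof.
move=> le_mu /skew_SITP[H1 _ _] i.
rewrite -(card_row_lt (leq_trans (le_mu i) (part_leq la_sum i))).
apply: eq_card => j; rewrite !inE ltnS leqn0 eqn0Ngt H1 negb_and /=.
case: (boolP (in_shape la (i, j))) => [_|]; first by rewrite ltnNge.
by rewrite /in_shape /= -leqNgt => /(leq_trans (le_mu i)); rewrite leqNgt => /negPf ->.
Qed.

Lemma nu_pred_filling T k : (0 < k)%N -> nu la (pred_filling T) k =1 nu la T k.+1.
Proof.
move=> k0 i; apply: eq_card => j; rewrite !inE pred_fillingE; congr (_ && _).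
by case: (nat_of_ord _).
Qed.

(** The factor at [k = 1] sees the inner shape [mu]; in the others, lowering the entries by 1 shifts
    [k]. *)
Lemma SIT_weight_pred mu T (p : 'I_d) :
    (forall i, mu i <= lam i)%N -> (mu p < lam p)%N -> skew_SIT la mu T ->
  SIT_weight T = (level_weight mu)^-1 * SIT_weight (pred_filling T).
Proof.
move=> le_mu lt_p sT; have /skew_SITP[H1 _ _] := sT.
have lt_n : (mu p < n)%N := leq_trans lt_p (part_leq la_sum p).
have mT0 : (0 < mT T)%N.
  apply: leq_trans (leq_mT T (p, Ordinal lt_n)).
  by rewrite H1 /in_shape /= leqnn andbT.
rewrite /SIT_weight big_ltn // mT_pred prednK // big_add1 /=.
rewrite (eq_level_weight (nu1_skew_SIT le_mu sT)); congr (_ * _).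
rewrite !big_nat; apply: eq_bigr => k /andP[k0 _]; congr (_^-1).
by apply: eq_level_weight => i; rewrite nu_pred_filling.
Qed.

Hypothesis level_weight_neq0 : forall mu (p : 'I_d),
  {homo mu : i i' / (i <= i')%N >-> (i' <= i)%N} ->
  (forall i, mu i <= lam i)%N -> (mu p < lam p)%N -> level_weight mu != 0.
Hypothesis diag_neq0 : bialternant x z lam != 0.

Lemma skew_SIT_full T : skew_SIT la lam T = (T == [ffun=> ord0]).
Proof.
have outside (c : 'I_d * 'I_n) : in_shape la c && (lam c.1 <= c.2)%N = false.
  by rewrite /in_shape ltnNge andNb.
apply/skew_SITP/eqP => [[H1 _ _] | ->].
  apply/ffunP=> c; apply/val_inj; have := H1 c.
  by rewrite ffunE outside /=; case: (nat_of_ord _).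
split=> [c | c c' _ | k]; first by rewrite ffunE outside.
  by rewrite ffunE.
by rewrite /mT big1 => [|c _]; [lia | rewrite ffunE].
Qed.

(** Induction on the number of cells of [la / mu]; at [mu = lam] only the zero filling remains, with
    empty product 1. *)
Lemma sum_skew_SIT mu :
    {homo mu : i i' / (i <= i')%N >-> (i' <= i)%N} ->
    (forall i, mu i <= lam i)%N ->
  \sum_(T : filling d n | skew_SIT la mu T) SIT_weight T =
  bialternant x z mu / bialternant x z lam.
Proof.
have [r] := ubnP (\sum_(i < d) (lam i - mu i))%N.
elim: r mu => // r IHr mu lt_r mu_mono le_mu.
have [/existsP[p lt_p] | full] := boolP [exists p, (mu p < lam p)%N]; last first.
  have mu_lam : mu =1 lam.
    move=> i; apply/eqP; rewrite eqn_leq le_mu leqNgt; apply: contra full => lt_i.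
    by apply/existsP; exists i.
  rewrite (eq_bialternant _ _ mu_lam) divff //.
  rewrite (big_pred1 [ffun=> ord0]) => [|T].
    by rewrite /SIT_weight big_geq // /mT big1 // => c _; rewrite ffunE.
  rewrite /= -skew_SIT_full; apply/skew_SITP/skew_SITP => -[H1 H2 H3]; split=> // c.
    by rewrite -mu_lam.
  by rewrite mu_lam.
have w0 := level_weight_neq0 mu_mono le_mu lt_p.
pose P S := [&& S != set0, S \subset addable mu & [forall i in S, (mu i < lam i)%N]].
rewrite (sum_skew_SIT_rec la_mono la_sum _ mu_mono lt_p).
transitivity (\sum_(S : {set 'I_d} | P S)
    (level_weight mu)^-1 * (bialternant x z (add_rows mu S) / bialternant x z lam)).
  apply: eq_bigr => S /and3P[S0 Sadd /forall_inP Slt].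
  have lt_S : (\sum_(i < d) (lam i - add_rows mu S i) < r)%N.
    rewrite -ltnS; apply: leq_trans lt_r; have /set0Pn[i iS] := S0.
    rewrite ltnS (bigD1 i) //= [X in (_ <= X)%N](bigD1 i) //= -addSn.
    apply: leq_add.
      by rewrite /add_rows iS addn1 subnS prednK // subn_gt0; exact: Slt.
    by apply: leq_sum => j _; rewrite leq_sub2l ?leq_addr.
  have le_S i : (add_rows mu S i <= lam i)%N.
    by rewrite /add_rows; case: (boolP (i \in S)) => [/Slt | _]; rewrite ?addn0 ?addn1.
  rewrite -(IHr _ lt_S (add_rows_mono mu_mono Sadd) le_S) big_distrr /=.
  apply: eq_bigr => T sT.
  rewrite (SIT_weight_pred le_mu lt_p (skew_SIT_succ la_sum S0 Sadd Slt sT)).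
  by rewrite (succ_fillingK la_sum S0 Slt sT).
rewrite -big_distrr -big_distrl /=.
suff -> : \sum_(S | P S) bialternant x z (add_rows mu S) =
    level_weight mu * bialternant x z mu by field; rewrite w0 diag_neq0.
(* The [- 1] in [level_weight] cancels the term [S = set0] of the Chevalley rule. *)
rewrite /level_weight mulrBl mul1r bialternant_Chevalley //.
rewrite [X in X - _](bigD1 set0) ?sub0set //=.
rewrite [X in X + _ - _](@eq_bialternant _ _ _ _ _ mu) => [|i]; last first.
  by rewrite /add_rows inE addn0.
rewrite addrC addKr.
(* Sets [S] that leave the diagram of [la] contribute 0 by [bialternant_eq0]. *)
rewrite [RHS](bigID (fun S => [forall i in S, (mu i < lam i)%N])) /=.
rewrite [X in _ = _ + X]big1 ?addr0 => [|S /andP[/andP[Sadd _]]].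
  by apply: eq_bigl => S; rewrite /P [in RHS]andbAC [RHS]andbC !andbA.
rewrite negb_forall_in => /exists_inP[i iS]; rewrite -leqNgt => le_i.
have lam_mono : {homo lam : j j' / (j <= j')%N >-> (j' <= j)%N}.
  by move=> j j'; apply: la_mono.
have lt_i : (lam i < add_rows mu S i)%N by rewrite /add_rows iS addn1.
have zE j : z j = x (lam j + d - j) by [].
exact: (bialternant_eq0 x_neq0 lam_mono zE (add_rows_mono mu_mono Sadd) lt_i).
Qed.

End HookSum.

(** * The conjugate partition and the complement of the shifted parts *)

Section ConjugatePartition.
Variable la : seq nat.
Hypothesis la_sorted : sorted geq la.

Lemma geq_trans : transitive geq.
Proof. by move=> a b c ab bc; apply: leq_trans bc ab. Qed.

Lemma part_mono : {homo part la : i i' / (i <= i')%N >-> (i' <= i)%N}.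
Proof.
move=> i i' le_i; rewrite /part; have [lt_i' | ge_i'] := ltnP i' (size la).
  apply: (sorted_leq_nth geq_trans leqnn 0%N la_sorted) => //.
  exact: leq_ltn_trans lt_i'.
by rewrite [X in (X <= _)%N]nth_default.
Qed.

(** In a weakly decreasing list the entries at least [j] form an initial segment. Row [a] counts
    from 0, column [j] from 1; [0 < j] excludes the default part 0 beyond the list. *)
Lemma ltn_conj_part (a j : nat) : (0 < j)%N ->
  (a < conj_part la j)%N = (j <= part la a)%N.
Proof.
move=> j0; move: la_sorted; rewrite /conj_part /part.
elim: la a => [|h t IHt] a /=; first by rewrite nth_nil ltn0 leqn0; case: j j0.
move=> ht; have /allP t_le := order_path_min geq_trans ht.
have [le_jh | lt_hj] := leqP j h.
  by case: a => [|a] /=; rewrite add1n ?le_jh // ltnS IHt ?(path_sorted ht).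
rewrite [count _ t](_ : _ = 0%N); last first.
  apply/eqP; rewrite -leqn0 leqNgt -has_count; apply/hasPn => k /t_le /= le_kh.
  by rewrite -ltnNge (leq_ltn_trans le_kh).
rewrite ltn0; symmetry; apply/negbTE; rewrite -ltnNge; case: a => [|a] //=.
have [lt_a | ge_a] := ltnP a (size t); last by rewrite nth_default.
by apply: leq_ltn_trans lt_hj; apply: t_le; rewrite mem_nth.
Qed.

(* In 1-based notation: {1, ..., la_i + d - i} is the disjoint union of the
   la_j + d - j + 1 for j > i and of the d + j - la'_j for 1 <= j <= la_i. *)
Lemma perm_shifted_parts (d i : nat) : (size la <= d)%N -> (i < d)%N ->
  perm_eq (index_iota 1 (part la i + d - i))
    ([seq part la j + d - j | j <- index_iota i.+1 d]
      ++ [seq d + j.+1 - conj_part la j.+1 | j <- index_iota 0 (part la i)])%N.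
Proof.
move=> le_d lt_id; rewrite perm_sym.
have conj_le j : (conj_part la j <= d)%N := leq_trans (count_size _ _) le_d.
have conjP a j : (a < conj_part la j.+1)%N = (j < part la a)%N by apply: ltn_conj_part.
set s := _ ++ _.
have s_uniq : uniq s.
  rewrite cat_uniq; apply/and3P; split.
  - rewrite map_inj_in_uniq ?iota_uniq // => a b; rewrite !mem_index_iota => la_ lb_ e.
    have [lt|lt|//] := ltngtP a b; first by have := part_mono (ltnW lt); lia.
    by have := part_mono (ltnW lt); lia.
  (* A common value would give $b+1-\lambda'_{b+1}=\lambda_a-a$ (row $a$ from 0). By [conjP] the
     left side is smaller if cell $(a,b)$ lies in the diagram, and larger otherwise. *)
  - apply/hasPn => _ /mapP[b + ->]; rewrite mem_index_iota => lb_.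
    apply/mapP => -[a]; rewrite mem_index_iota => la_.
    by have := conjP a b; have := conj_le b.+1; lia.
  - rewrite map_inj_in_uniq ?iota_uniq // => a b; rewrite !mem_index_iota => la_ lb_ e.
    have conj_anti a' b' : (a' <= b' -> conj_part la b'.+1 <= conj_part la a'.+1)%N.
      by move=> le_ab; apply: sub_count => k /=; lia.
    have [lt|lt|//] := ltngtP a b; last first.
      by have := conj_anti _ _ (ltnW lt); have := conj_le b.+1; lia.
    by have := conj_anti _ _ (ltnW lt); have := conj_le a.+1; lia.
have s_sub : {subset s <= index_iota 1 (part la i + d - i)}.
  move=> k; rewrite mem_cat => /orP[] /mapP[j]; rewrite !mem_index_iota => lj ->.
    have le_ij : (i <= j)%N by lia.
    by have := part_mono le_ij; lia.
  by have := conjP i j; have := conj_le j.+1; lia.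
(* Both lists have [part la i + d - i - 1] elements, so the inclusion of [s] is an equality of
   sets. *)
have s_size : (size (index_iota 1 (part la i + d - i)) <= size s)%N.
  by rewrite size_cat !size_map !size_iota; lia.
apply: uniq_perm => //; first exact: iota_uniq.
by have [] := uniq_min_size s_uniq s_sub s_size.
Qed.

(** For [f k = x k - z i] this splits the denominator in [bialternant_ratio] into the Vandermonde
    factors of row [i], which cancel, and one factor per cell of the row. *)
Lemma prod_shifted_parts (R : comNzRingType) (f : nat -> R) (d n : nat) (i : 'I_d) :
    (size la <= d)%N -> (part la i <= n)%N ->
  \prod_(1 <= k < part la i + d - i) f k =
  (\prod_(j < d | (i < j)%N) f (part la j + d - j)%N) *
  \prod_(j < n | (j < part la i)%N) f (d + j.+1 - conj_part la j.+1)%N.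
Proof.
move=> le_d le_n; rewrite (perm_big _ (perm_shifted_parts le_d (ltn_ord i))) big_cat /=.
rewrite !big_map; congr (_ * _).
  by rewrite (big_nat_widenl _ 0) // big_mkord.
by rewrite (big_nat_widen _ _ n) // big_mkord.
Qed.

End ConjugatePartition.

(** * The ratio of bialternants as a hook product *)

Section HookProduct.
Variables (F : fieldType) (x : nat -> F) (la : seq nat) (d n : nat).
Hypothesis x_neq0 : forall k, x k != 0.
Hypothesis la_sorted : sorted geq la.
Hypothesis size_la : (size la <= d)%N.
Hypothesis la_sum : (\sum_(i < d) part la i = n)%N.
Hypothesis x_inj : forall k l, (0 < k < l)%N -> (l <= part la 0 + d)%N -> x k != x l.

Let z (i : 'I_d) : F := x (part la i + d - i).

Lemma subx_neq0 k (i : 'I_d) : (0 < k < part la i + d - i)%N -> x k - z i != 0.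
Proof.
move=> lt_k; rewrite subr_eq0; apply: x_inj => //.
by have := part_mono la_sorted (leq0n i); lia.
Qed.

Lemma bialternant_diag_neq0 : bialternant x z (fun i => part la i) != 0.
Proof.
rewrite (bialternant_diag (lam := fun i : 'I_d => part la i) x_neq0) //; last first.
  by move=> i i'; apply: part_mono.
apply/prodf_neq0 => i _; apply: mulf_neq0; last by rewrite invr_eq0 expf_neq0 /z.
rewrite kpow_mul /z //; apply: mulf_neq0; last by rewrite invr_eq0 expf_neq0.
by rewrite prodf_seq_neq0; apply/allP => k; rewrite mem_index_iota => /subx_neq0.
Qed.

Lemma bialternant_ratio_hook :
  bialternant x z (fun=> 0%N) / bialternant x z (fun i => part la i) =
  (\prod_(i < d) z i ^+ part la i) *
  \prod_(c : 'I_d * 'I_n | in_shape la c)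
    (x (d + c.2.+1 - conj_part la c.2.+1) - z c.1)^-1.
Proof.
rewrite (bialternant_ratio (lam := fun i : 'I_d => part la i) x_neq0) //; last first.
  by move=> i i'; apply: part_mono.
rewrite -(pair_big_dep xpredT (fun (i : 'I_d) (j : 'I_n) => (j < part la i)%N)
  (fun i j => (x (d + j.+1 - conj_part la j.+1) - z i)^-1)) /=.
rewrite -big_split /=; apply: eq_bigr => i _.
rewrite (prod_shifted_parts la_sorted (fun k => x k - z i) size_la (part_leq la_sum i)).
rewrite prodfV -mulrA; congr (_ * _).
have P0 : \prod_(j < d | (i < j)%N) (z j - z i) != 0.
  apply/prodf_neq0 => j lt_ij; apply: subx_neq0.
  by have := part_mono la_sorted (ltnW lt_ij); have := ltn_ord j; lia.
by rewrite invfM mulrA divff ?mul1r.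
Qed.

End HookProduct.

(** * Nonvanishing of rational functions, tested by evaluating polynomials *)

Section Genericity.
Variable N : nat.

Definition xgen (k : nat) : RF N.+1 := 1 + beta N * yv N k.

Let px (k : nat) : {mpoly rat[N.+1]} := 1 + 'X_(@ord0 N) * 'X_(@inord N k).

(* beta = 1, y_l = -1 and all other y_k = 0. *)
Let pt (l : nat) (i : 'I_N.+1) : rat :=
  if i == ord0 then 1 else if i == inord l then -1 else 0.

Lemma xgenE k : xgen k = FracField.tofrac (px k).
Proof. by rewrite /xgen /px rmorphD rmorphM rmorph1. Qed.

Lemma meval_px l k : (0 < k <= N)%N -> (0 < l <= N)%N ->
  (px k).@[pt l] = (k != l)%:R.
Proof.
move=> k0 l0; rewrite /px mevalD meval1 mevalM !mevalXU /pt eqxx mul1r.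
rewrite -!val_eqE /= !inordK; try lia.
by case: eqVneq => [e | _]; [lia |]; case: eqVneq => _; rewrite ?subrr ?addr0.
Qed.

Lemma xgen_neq0 k : xgen k != 0.
Proof.
rewrite xgenE tofrac_eq0; apply/eqP => /(congr1 (meval (fun=> 0))).
by rewrite /px mevalD meval1 mevalM !mevalXU mul0r addr0 meval0 => /eqP; rewrite oner_eq0.
Qed.

Lemma xgen_inj k l : (0 < k < l)%N -> (l <= N)%N -> xgen k != xgen l.
Proof.
move=> k0 lN; rewrite !xgenE tofrac_eq; apply/eqP => /(congr1 (meval (pt l))).
rewrite !meval_px; try lia.
by rewrite eqxx (_ : k != l) => [/eqP|]; [rewrite oner_eq0 | lia].
Qed.

(** Let [i] be the first row with [mu i < part la i], and evaluate where only the variable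
    $x_{\lambda_i+d-i}$ vanishes. The product for [la] is 0, that for [mu] is not: rows [j < i] have
    [mu j = part la j] and a larger index, rows [j >= i] a smaller one. *)
Lemma xgen_level_weight (la : seq nat) d (mu : 'I_d -> nat) (p : 'I_d) :
    sorted geq la -> (part la 0 + d <= N)%N ->
    {homo mu : i i' / (i <= i')%N >-> (i' <= i)%N} ->
    (forall i : 'I_d, mu i <= part la i)%N -> (mu p < part la p)%N ->
  level_weight xgen la mu != 0.
Proof.
move=> la_sorted leN mu_mono le_mu lt_p; rewrite /level_weight subr_eq0 prodf_div.
have Q0 : \prod_(i < d) xgen (part la i + d - i) != 0.
  by apply/prodf_neq0 => i _; apply: xgen_neq0.
apply/negP; rewrite -(inj_eq (mulIf Q0)) divfK // mul1r.
under eq_bigr => i _ do rewrite xgenE.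
under [X in _ == X]eq_bigr => i _ do rewrite xgenE.
rewrite -!rmorph_prod tofrac_eq => /eqP.
case: (@arg_minnP _ p (fun i => mu i < part la i)%N (@nat_of_ord d) lt_p) => i lt_i min_i.
have bnd (j : 'I_d) m : (m <= part la j)%N -> (0 < m + d - j <= N)%N.
  by have := part_mono la_sorted (leq0n j); have := ltn_ord j; lia.
move/(congr1 (meval (pt (part la i + d - i)))); rewrite !rmorph_prod /=.
rewrite [X in _ = X -> _](bigD1 i) //= meval_px ?bnd // eqxx mul0r => /eqP.
apply/negP/prodf_neq0 => j _; rewrite meval_px ?bnd //.
case: (eqVneq (_ - _)%N) => [e | _]; last exact: oner_neq0.
exfalso.
have [lt_ji | le_ij] := ltnP j i.
  have [lt_j | ge_j] := ltnP (mu j) (part la j); first by have := min_i _ lt_j; lia.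
  by have := le_mu j; have := part_mono la_sorted (ltnW lt_ji); have := ltn_ord i; lia.
by have := mu_mono _ _ le_ij; have := ltn_ord j; lia.
Qed.

End Genericity.

(** * Both halves combined at $x_k=1+\beta y_k$ *)

Theorem theorem4p2 (d n N : nat) (la : seq nat) :
  (0 < d)%N -> is_partition la -> (size la <= d)%N -> sumn la = n ->
  (part la 0 + d <= N)%N ->
  \sum_(T : filling d n | is_SIT la T)
     \prod_(1 <= k < (mT T).+1)
        ((\prod_(i < d)
            ((1 + beta N * yv N (nu la T k i + d - i)) /
             (1 + beta N * yv N (part la i + d - i)))) - 1)^-1
  = (beta N ^+ n)^-1
    * (\prod_(i < d) (1 + beta N * yv N (part la i + d - i)) ^+ part la i)
    * \prod_(c : 'I_d * 'I_n | in_shape la c)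
        (yv N (d + c.2.+1 - conj_part la c.2.+1) - yv N (part la c.1 + d - c.1))^-1.
Proof.
move=> d0 /andP[la_sorted _] size_la la_sum leN.
have sum_la : (\sum_(i < d) part la i = n)%N.
  rewrite -la_sum sumnE (big_nth 0%N) (big_nat_widen _ _ d) // big_mkord.
  rewrite [LHS](bigID (fun i : 'I_d => (i < size la)%N)) /= [X in (_ + X)%N]big1 ?addn0 //.
  by move=> i; rewrite -leqNgt => le_i; rewrite /part nth_default.
have part_mono := part_mono la_sorted.
have x0 := xgen_neq0 N.
have x_inj k l : (0 < k < l)%N -> (l <= part la 0 + d)%N -> xgen N k != xgen N l.
  by move=> lt_k /leq_trans/(_ leN); apply: xgen_inj.
rewrite (eq_bigl (skew_SIT la (fun=> 0%N))) => [|T]; last exact: is_SIT_skew.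
rewrite (sum_skew_SIT x0 part_mono sum_la) //; first last.
- exact: bialternant_diag_neq0.
- by move=> mu p mu_mono le_mu; apply: xgen_level_weight.
rewrite (bialternant_ratio_hook x0 la_sorted size_la sum_la x_inj) -mulrA [RHS]mulrCA; congr (_ * _).
(* Each of the [n] cells absorbs one $\beta$, since $x_k-x_l=\beta(y_k-y_l)$. *)
have -> : beta N ^+ n = \prod_(c : 'I_d * 'I_n | in_shape la c) beta N.
  by rewrite prodr_const -[in LHS](card_shape sum_la) cardsE.
rewrite -prodfV -big_split /=; apply: eq_bigr => c _.
by rewrite -invfM mulrBr /xgen opprD addrACA subrr add0r.
Qed.
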